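(* Suppose that Assumptions 1, 2 and 3 stated in the context hold, and let $\{x_k\}$ be the iterates of the ASMOP algorithm described in the context. Then $$P\Big(\liminf_{k\to\infty}\omega(x_k)=0\ \Big|\ FS\Big)=1.$$
   Context: **Problem.** Consider $\min_{x\in\mathbb{R}^n} f(x)=(f^1(x),\dots,f^q(x))^T$ with $f^i(x)=\frac1N\sum_{j\in\mathcal{N}^i}f^i_j(x)$, $i=1,\dots,q$, where each $\mathcal{N}^i$ is an index set with $|\mathcal{N}^i|=N$ (identified with $\{1,\dots,N\}$); the component functions are smooth with Lipschitz-continuous gradients. The marginal function is $\omega(x)=-\min_{\|d\|\le1}\max_{i}\langle\nabla f^i(x),d\rangle$. Put $\phi(x)=\max_i f^i(x)$. **Subsampled quantities.** For $\mathcal{N}_k=(\mathcal{N}_k^1,\dots,\mathcal{N}_k^q)$ with $\emptyset\ne\mathcal{N}^i_k\subseteq\mathcal{N}^i$, $N_k^i=|\mathcal{N}_k^i|$, let $f^i_{\mathcal{N}^i_k}=\frac1{N^i_k}\sum_{j\in\mathcal{N}^i_k}f^i_j$, $\phi_{\mathcal{N}_k}(x)=\max_i f^i_{\mathcal{N}^i_k}(x)$, $\omega_{\mathcal{N}_k}(x)=-\min_{\|d\|\le1}\max_i\langle\nabla f^i_{\mathcal{N}^i_k}(x),d\rangle$. With Hessian approximations $H^i_k$, the model is $m_{\mathcal{N}_k}(d)=\max_i\{f^i_{\mathcal{N}^i_k}(x_k)+\langle\nabla f^i_{\mathcal{N}^i_k}(x_k),d\rangle+\frac12\langle d,H^i_kd\rangle\}$,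 and $\beta_k=1+\max_i\|H^i_k\|$. For a sample (with possible repetitions) $\mathcal{D}_k=(\mathcal{D}^1_k,\dots,\mathcal{D}^q_k)$ with $D_k^i=|\mathcal{D}_k^i|$, let $f^i_{\mathcal{D}^i_k}=\frac1{D^i_k}\sum_{j\in\mathcal{D}^i_k}f^i_j$ and $\phi_{\mathcal{D}_k}(x)=\max_i f^i_{\mathcal{D}^i_k}(x)$. Let $h^i_k=(N-N^i_k)/N$ and $M^k_b=\{i: N^i_k<N\}$. **Algorithm ASMOP.** Initialization: $x_0\in\mathbb{R}^n$, $\delta_{max}>0$, $\delta_0\in(0,\delta_{max})$, $\gamma_1\in(0,1)$, $\gamma_2=1/\gamma_1$, $\nu,\varepsilon>0$, $\eta\in(0,\frac34)$, predetermined sequences $t_k>0$, $\overline{t}_k>0$ with $\sum_{k\ge0}t_k\le t<\infty$, $\sum_{k\ge0}\overline{t}_k\le\overline{t}<\infty$, initial samples $\mathcal{N}_0$. At iteration $k=0,1,\dots$: Step 1. Find $d_k$ with $\|d_k\|\le\delta_k$ and $m_{\mathcal{N}_k}(0)-m_{\mathcal{N}_k}(d_k)\ge\frac12\omega_{\mathcal{N}_k}(x_k)\min\{\delta_k,\omega_{\mathcal{N}_k}(x_k)/\beta_k\}$. Set $x_t=x_k+d_k$ (the trial point) and $\rho_{\mathcal{N}_k}=\dfrac{\phi_{\mathcal{N}_k}(x_t)-\phi_{\mathcal{N}_k}(x_k)-\delta_kt_k}{m_{\mathcal{N}_k}(d_k)-m_{\mathcal{N}_k}(0)}$. Step 2 (sample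 update). If $M^k_b=\emptyset$ (FS phase), go to Step 3 (full samples are kept). Otherwise (MB phase), draw $\mathcal{D}_k$, independently of $\mathcal{N}_k$: for $i\in M^k_b$, $\mathcal{D}^i_k$ is drawn uniformly at random with replacement from $\mathcal{N}^i$ with size $D^i_k<N$; for $i\notin M^k_b$, $\mathcal{D}^i_k=\mathcal{N}^i$. Compute $\rho_{\mathcal{D}_k}=\dfrac{\phi_{\mathcal{D}_k}(x_t)-\phi_{\mathcal{D}_k}(x_k)-\delta_k\overline{t}_k}{-\max_i\|\nabla f^i_{\mathcal{D}^i_k}(x_k)\|}$; the condition $\rho_{\mathcal{D}_k}\ge\nu$ is understood as $\phi_{\mathcal{D}_k}(x_t)\le\phi_{\mathcal{D}_k}(x_k)+\delta_k\overline{t}_k-\nu\max_i\|\nabla f^i_{\mathcal{D}^i_k}(x_k)\|$. For each $i\in M^k_b$: if $\omega_{\mathcal{N}_k}(x_k)<\varepsilon h^i_k$ or $\rho_{\mathcal{D}_k}<\nu$, choose $N^i_{k+1}\in(N^i_k,N]$ and choose a new $\mathcal{N}^i_{k+1}$ of that size; otherwise, if $\rho_{\mathcal{N}_k}<\eta$, set $N^i_{k+1}=N^i_k$ and $\mathcal{N}^i_{k+1}=\mathcal{N}^i_k$; otherwise set $N^i_{k+1}=N^i_k$ and choose $\mathcal{N}^i_{k+1}$ of that size. For $i\notin M_b^k$ the full sample is kept. Step 3 (iterate update). In the MB phase ($M^k_b\ne\emptyset$): $x_{k+1}=x_t$ if $\rho_{\mathcal{N}_k}\ge\eta$ and $\rho_{\mathcal{D}_k}\ge\nu$,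 else $x_{k+1}=x_k$. In the FS phase ($M^k_b=\emptyset$): $x_{k+1}=x_t$ if $\rho_{\mathcal{N}_k}\ge\eta$, else $x_{k+1}=x_k$. Step 4 (radius update). $\delta_{k+1}=\min\{\delta_{max},\gamma_2\delta_k\}$ if $\rho_{\mathcal{N}_k}\ge\eta$, else $\delta_{k+1}=\gamma_1\delta_k$. **Scenarios.** For a sample path, $M_b=\{i: N^i_k<N\ \forall k\in\mathbb{N}\}$. MB is the event (set of sample paths) $M_b\ne\emptyset$; FS is the event $M_b=\emptyset$. The set $\mathcal{D}_k^-$ denotes the set of possible outcomes of $\mathcal{D}_k$ for which $\phi_{\mathcal{D}_k}(x_t)>\phi_{\mathcal{D}_k}(x_k)+\delta_k\overline{t}_k-\nu\max_i\|\nabla f^i_{\mathcal{D}^i_k}(x_k)\|$. On MB, $k_0$ denotes a random finite iteration (existing almost surely on MB) such that $\mathcal{D}^-_k=\emptyset$ for all $k\ge k_0$. On FS, $k_1$ denotes a random finite iteration such that $N^i_k=N$ for all $i$ and all $k\ge k_1$. **Assumption 1.** All functions $f^i_j$, $j\in\mathcal{N}^i$, $i=1,\dots,q$, are twice continuously differentiable and bounded from below. **Assumption 2.** There is $c_h>0$ with $\|\nabla^2f^i_j(x)\|\le c_h$ for all $x\in\mathbb{R}^n$, $j\in\mathcal{N}^i$, $i=1,\dots,q$, and there is $c_b>0$ with $\beta_k\le c_b$ for all $k\in\mathbb{N}$. **Assumption 3.** There is $C>0$ such that for all $i=1,\dots,q$ and $j\in\mathcal{N}^i$: $\mathbb{E}(|f^i_j(x_{k_0})|\mid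 MB)\le C$ and $\mathbb{E}(|f^i_j(x_{k_1})|\mid FS)\le C$. (Conditioning on MB or FS is understood when that event has positive probability.) *)

(* Defs.v *)
From mathcomp Require Export all_boot all_order all_algebra.
From mathcomp Require Export all_classical all_reals all_analysis.

Set Implicit Arguments.
Unset Strict Implicit.
Unset Printing Implicit Defensive.

Export Order.TTheory GRing.Theory Num.Theory.
Export numFieldNormedType.Exports.
Local Open Scope classical_set_scope.
Local Open Scope ring_scope.

(** * Euclidean structure and calculus on R^n *)

Section Euclidean.
Variables (R : realType) (n : nat).

Definition dotv (u v : 'rV[R]_n) : R := (u *m v^T) 0 0.

(* The library norm on ['rV[R]_n] is the max norm; this is the 2-norm. *)
Definition enorm (v : 'rV[R]_n) : R := Num.sqrt (dotv v v).

(* Square matrices act on row vectors on the right.  The supremum is over a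
   nonempty bounded set, so it is the operator norm induced by [enorm]. *)
Definition opnorm (A : 'M[R]_n) : R :=
  sup [set enorm (v *m A) | v in [set v | enorm v <= 1]].

Definition grad (g : 'rV[R]_n -> R) (x : 'rV[R]_n) : 'rV[R]_n :=
  \row_i 'D_(delta_mx 0 i) g x.

Definition hessian (g : 'rV[R]_n -> R) (x : 'rV[R]_n) : 'M[R]_n :=
  'J (grad g) x.

Definition twice_continuously_differentiable (g : 'rV[R]_n -> R) : Prop :=
  [/\ forall x, differentiable g x,
      forall x, differentiable (grad g) x
    & continuous (hessian g)].

Definition bounded_from_below (g : 'rV[R]_n -> R) : Prop :=
  exists c : R, forall x, c <= g x.

Definition lipschitz_gradient (g : 'rV[R]_n -> R) : Prop :=
  exists L : R, forall x y, enorm (grad g x - grad g y) <= L * enorm (x - y).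

End Euclidean.

(** * Finite-sum multi-objective problem *)

(* There are [q.+1] >= 1 objectives and each index set is ['I_N]. *)
Section Problem.
Variables (R : realType) (n q N : nat).

Definition maxq (F : 'I_q.+1 -> R) : R :=
  \big[Num.max/F ord0]_(i < q.+1) F i.

Definition phi (g : 'I_q.+1 -> 'rV[R]_n -> R) (x : 'rV[R]_n) : R :=
  maxq (fun i => g i x).

(* The infimum is attained: the unit ball is compact and the inner maximum is
   continuous in the direction. *)
Definition marginal (g : 'I_q.+1 -> 'rV[R]_n -> R) (x : 'rV[R]_n) : R :=
  - inf [set maxq (fun i => dotv (grad (g i) x) v) | v in [set v | enorm v <= 1]].

Variable f : 'I_q.+1 -> 'I_N -> 'rV[R]_n -> R.

Definition objective (i : 'I_q.+1) (x : 'rV[R]_n) : R :=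
  N%:R^-1 * \sum_(j < N) f i j x.

Definition set_average (S : 'I_q.+1 -> {set 'I_N}) (i : 'I_q.+1)
    (x : 'rV[R]_n) : R :=
  #|S i|%:R^-1 * \sum_(j in S i) f i j x.

(* Samples with possible repetitions are sequences. *)
Definition seq_average (s : 'I_q.+1 -> seq 'I_N) (i : 'I_q.+1)
    (x : 'rV[R]_n) : R :=
  (size (s i))%:R^-1 * \sum_(j <- s i) f i j x.

Definition smooth_components : Prop :=
  forall i j, (forall x, differentiable (f i j) x) /\ lipschitz_gradient (f i j).

End Problem.

(** * The ASMOP algorithm along one sample path *)

Record asmop_params (R : realType) := AsmopParams {
  delta_max : R;
  delta_init : R;
  gamma1 : R;
  nu : R;
  eps : R;
  eta : R;
  tseq : nat -> R;
  tbarseq : nat -> R }.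

Definition gamma2 (R : realType) (p : asmop_params R) : R := (gamma1 p)^-1.

Definition positive_summable (R : realType) (u : nat -> R) : Prop :=
  (forall k, 0 < u k) /\
  exists t : R, (\sum_(0 <= k <oo) (u k)%:E <= t%:E)%E.

Definition valid_params (R : realType) (p : asmop_params R) : Prop :=
  [/\ 0 < delta_init p < delta_max p,
      0 < gamma1 p < 1,
      0 < nu p /\ 0 < eps p,
      0 < eta p < 3 / 4
    & positive_summable (tseq p) /\ positive_summable (tbarseq p)].

(* Iteration data: iterate [x_k], radius [delta_k], subsamples [N_k^i], matrices
   [H_k^i], step [d_k], and additional samples [D_k^i]. *)
Record state (R : realType) (n q N : nat) := State {
  iterate : 'rV[R]_n;
  radius : R;
  smp : 'I_q.+1 -> {set 'I_N};
  happrox : 'I_q.+1 -> 'M[R]_n;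
  dir : 'rV[R]_n;
  dsmp : 'I_q.+1 -> seq 'I_N }.

Section Algorithm.
Variables (R : realType) (n q N : nat).
Variable f : 'I_q.+1 -> 'I_N -> 'rV[R]_n -> R.
Variable p : asmop_params R.
Implicit Types (s : state R n q N) (k : nat).

Definition trial s : 'rV[R]_n := iterate s + dir s.

Definition submarginal s : R := marginal (set_average f (smp s)) (iterate s).

Definition model s (v : 'rV[R]_n) : R :=
  maxq (fun i => set_average f (smp s) i (iterate s)
                 + dotv (grad (set_average f (smp s) i) (iterate s)) v
                 + 2^-1 * dotv v (v *m happrox s i)).

Definition beta s : R := 1 + maxq (fun i => opnorm (happrox s i)).

Definition hfrac s (i : 'I_q.+1) : R := (N - #|smp s i|)%N%:R / N%:R.

Definition nonfull s (i : 'I_q.+1) : bool := (#|smp s i| < N)%N.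

Definition mb_phase s : bool := [exists i, nonfull s i].

Definition adequate_step s : Prop :=
  enorm (dir s) <= radius s /\
  2^-1 * submarginal s * Num.min (radius s) (submarginal s / beta s)
    <= model s 0 - model s (dir s).

(* If the denominator vanishes, which forces [submarginal s = 0], the quotient
   is 0 and the iteration is unsuccessful. *)
Definition rhoN k s : R :=
  (phi (set_average f (smp s)) (trial s) - phi (set_average f (smp s)) (iterate s)
     - radius s * tseq p k) / (model s (dir s) - model s 0).

(* The condition [rho_D >= nu], for the outcome [D] of the additional samples,
   in its division-free form. *)
Definition accepts k s (D : 'I_q.+1 -> seq 'I_N) : Prop :=
  phi (seq_average f D) (trial s)
    <= phi (seq_average f D) (iterate s) + radius s * tbarseq p k
       - nu p * maxq (fun i => enorm (grad (seq_average f D i) (iterate s))).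

Definition successful k s : Prop := eta p <= rhoN k s.

(* Outside the set of non-full indices [D_k^i] is the full index set; in the FS
   phase this is only a default value, never used by the algorithm. *)
Definition additional_sizes s : Prop :=
  forall i, if nonfull s i then is_true (0 < size (dsmp s i) < N)%N
            else dsmp s i = enum 'I_N.

Definition sample_update k s (s' : state R n q N) : Prop :=
  forall i,
    if nonfull s i then
      ((submarginal s < eps p * hfrac s i \/ ~ accepts k s (dsmp s)) ->
         (#|smp s i| < #|smp s' i|)%N)
      /\ (~ (submarginal s < eps p * hfrac s i \/ ~ accepts k s (dsmp s)) ->
          ~ successful k s -> smp s' i = smp s i)
      /\ (~ (submarginal s < eps p * hfrac s i \/ ~ accepts k s (dsmp s)) ->
          successful k s -> #|smp s' i| = #|smp s i|)
    else smp s' i = smp s i.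

Definition move_condition k s : Prop :=
  successful k s /\ (mb_phase s -> accepts k s (dsmp s)).

Definition iterate_update k s (s' : state R n q N) : Prop :=
  (move_condition k s -> iterate s' = trial s) /\
  (~ move_condition k s -> iterate s' = iterate s).

Definition radius_update k s (s' : state R n q N) : Prop :=
  (successful k s ->
     radius s' = Num.min (delta_max p) (gamma2 p * radius s)) /\
  (~ successful k s -> radius s' = gamma1 p * radius s).

Definition asmop_path (x0 : 'rV[R]_n) (r : nat -> state R n q N) : Prop :=
  [/\ iterate (r 0%N) = x0,
      radius (r 0%N) = delta_init p,
      forall k i, (0 < #|smp (r k) i|)%N
    & forall k,
        [/\ adequate_step (r k),
            additional_sizes (r k),
            sample_update k (r k) (r k.+1),
            iterate_update k (r k) (r k.+1)
          & radius_update k (r k) (r k.+1)]].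

(* [D_k^-]: the outcomes of the additional sampling, with the sizes chosen at
   iteration [k], that violate the acceptance condition. *)
Definition rejecting_outcomes k s : set ('I_q.+1 -> seq 'I_N) :=
  [set D | (forall i, if nonfull s i then size (D i) = size (dsmp s i)
                      else D i = enum 'I_N)
           /\ ~ accepts k s D].

End Algorithm.

(** * ASMOP as a stochastic process *)

Section Process.
Context {d : measure_display} {T : measurableType d}.
Variables (R : realType) (P : probability T R) (n q N : nat).
Implicit Type run : T -> nat -> state R n q N.

Definition filtration (F : nat -> set (set T)) : Prop :=
  forall k, [/\ sigma_algebra [set: T] (F k),
                F k `<=` F k.+1
              & F k `<=` measurable].

Definition real_measurable_wrt (G : set (set T)) (g : T -> R) : Prop :=
  forall B : set R, measurable B -> G (g @^-1` B).

(* For maps into countable types. *)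
Definition discrete_measurable_wrt (G : set (set T)) (U : Type) (g : T -> U)
    : Prop :=
  forall B : set U, G (g @^-1` B).

(* [F k] is the information available when [D_k] is drawn: everything in
   iteration [k] except [D_k] itself, but including the sizes of its
   components, is known. *)
Definition adapted (F : nat -> set (set T)) run : Prop :=
  forall k,
    [/\ (forall j, real_measurable_wrt (F k) (fun w => iterate (run w k) 0 j))
          /\ (forall j, real_measurable_wrt (F k) (fun w => dir (run w k) 0 j)),
        real_measurable_wrt (F k) (fun w => radius (run w k)),
        forall i a b, real_measurable_wrt (F k) (fun w => happrox (run w k) i a b),
        forall i, discrete_measurable_wrt (F k) (fun w => smp (run w k) i)
      & forall i,
          discrete_measurable_wrt (F k) (fun w => size (dsmp (run w k) i)) /\
          discrete_measurable_wrt (F k.+1) (fun w => dsmp (run w k) i)].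

(* Conditionally on [F k], and given the set [M] of non-full indices and the
   sample sizes, the [D_k^i] with [i] in [M] are independent and each consists
   of independent uniform draws from ['I_N]. *)
Definition uniform_draws (F : nat -> set (set T)) run : Prop :=
  forall k (A : set T) (M : {set 'I_q.+1}) (D : 'I_q.+1 -> seq 'I_N),
    F k A ->
    let E := [set w | (forall i, nonfull (run w k) i = (i \in M)) /\
                      (forall i, i \in M -> size (dsmp (run w k) i) = size (D i))] in
    P (A `&` E `&` [set w | forall i, i \in M -> dsmp (run w k) i = D i])
    = ((\prod_(i in M) (N%:R^-1 : R) ^+ size (D i))%R%:E * P (A `&` E))%E.

Definition asmop_process (f : 'I_q.+1 -> 'I_N -> 'rV[R]_n -> R)
    (p : asmop_params R) (x0 : 'rV[R]_n) run : Prop :=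
  (forall w, asmop_path f p x0 (run w)) /\
  exists F, [/\ filtration F, adapted F run & uniform_draws F run].

Definition MB run : set T :=
  [set w | exists i, forall k, (#|smp (run w k) i| < N)%N].

Definition FS run : set T := ~` MB run.

Definition mb_time (f : 'I_q.+1 -> 'I_N -> 'rV[R]_n -> R) (p : asmop_params R)
    run (k0 : T -> nat) : Prop :=
  measurable_fun [set: T] k0 /\
  {ae P, forall w, MB run w ->
     forall k, (k0 w <= k)%N -> rejecting_outcomes f p k (run w k) = set0}.

Definition fs_time run (k1 : T -> nat) : Prop :=
  measurable_fun [set: T] k1 /\
  forall w, FS run w -> forall k, (k1 w <= k)%N ->
    forall i, #|smp (run w k) i| = N.

(* Only used for events of positive probability. *)
Definition cond_prob (A B : set T) : \bar R := (P (A `&` B) / P B)%E.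

Definition cond_expectation (X : T -> R) (B : set T) : \bar R :=
  ((\int[P]_(w in B) (X w)%:E) / P B)%E.

(** * Assumptions *)

Variable f : 'I_q.+1 -> 'I_N -> 'rV[R]_n -> R.

Definition C2_bounded_below : Prop :=
  forall i j, twice_continuously_differentiable (f i j) /\
              bounded_from_below (f i j).

Definition bounded_hessians run : Prop :=
  (exists ch : R, 0 < ch /\ forall i j x, opnorm (hessian (f i j) x) <= ch) /\
  (exists cb : R, 0 < cb /\ forall w k, beta (run w k) <= cb).

Definition bounded_cond_expectations run (k0 k1 : T -> nat) : Prop :=
  exists C : R, 0 < C /\
    forall i j,
      ((0 < P (MB run))%E ->
         (cond_expectation (fun w => `|f i j (iterate (run w (k0 w)))|%R) (MB run)
            <= C%:E)%E) /\
      ((0 < P (FS run))%E ->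
         (cond_expectation (fun w => `|f i j (iterate (run w (k1 w)))|%R) (FS run)
            <= C%:E)%E).

End Process.

(* Main.v *)
Require Import Defs.
From mathcomp Require Import ring lra.

(** The conclusion holds on every single path of [FS], so the conditional
    probability is [P FS / P FS]; probability enters only through the
    measurability of [FS] (lemma [measurable_FS]).

    On a path of [FS] all samples are full from some iteration on, and the
    algorithm becomes a deterministic trust-region method for the true
    objectives, whose acceptance test tolerates increases of total size at most
    [delta_max * \sum_k t_k].  Suppose that the marginal function stays above
    some [e > 0].  By Lipschitz gradients, [phi] at the trial point exceeds
    the model by at most a multiple of [delta_k ^ 2] ([phi_trial_le]), whereas
    the predicted decrease is of order [delta_k] ([model_decrease]); hence every
    iteration with a small radius is successful, and the radii stay bounded away
    from 0 ([radius_bounded_away]).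

    A Lyapunov function then gives the contradiction
    ([trust_region_contradiction]).  Along successful iterations [phi] drops by
    a fixed amount up to the summable tolerance; along the others [phi] is
    unchanged but the radius shrinks by a fixed amount.  So for small enough
    [w > 0] the sum [phi + w * delta] drops by a fixed amount at every iteration
    up to summable errors, although it is bounded below. *)

Local Open Scope classical_set_scope.
Local Open Scope ring_scope.
Set Implicit Arguments.
Unset Strict Implicit.
Unset Printing Implicit Defensive.

(** * Euclidean norm, operator norm and the descent inequality *)

Section Euclidean_facts.
Variables (R : realType) (n : nat).
Implicit Types (u v x : 'rV[R]_n) (A : 'M[R]_n) (g : 'rV[R]_n -> R).

Lemma dotvE u v : dotv u v = \sum_j u 0 j * v 0 j.
Proof. by rewrite /dotv mxE; apply: eq_bigr => j _; rewrite mxE. Qed.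

Lemma dotv0 u : dotv u 0 = 0.
Proof. by rewrite dotvE big1 // => j _; rewrite mxE mulr0. Qed.

Lemma dotv_ge0 v : 0 <= dotv v v.
Proof. by rewrite dotvE sumr_ge0 // => j _; rewrite -expr2 sqr_ge0. Qed.

Lemma enorm_ge0 v : 0 <= enorm v.
Proof. exact: sqrtr_ge0. Qed.

Lemma sqr_enorm v : enorm v ^+ 2 = dotv v v.
Proof. by rewrite sqr_sqrtr ?dotv_ge0. Qed.

Lemma dotvZ (a : R) v : dotv (a *: v) (a *: v) = a ^+ 2 * dotv v v.
Proof.
rewrite !dotvE mulr_sumr; apply: eq_bigr => j _; rewrite !mxE; ring.
Qed.

Lemma enormZ (a : R) v : enorm (a *: v) = `|a| * enorm v.
Proof. by rewrite /enorm dotvZ sqrtrM ?sqr_ge0 // sqrtr_sqr. Qed.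

Lemma enorm0 : enorm (0 : 'rV[R]_n) = 0.
Proof. by rewrite /enorm dotv0 sqrtr0. Qed.

Lemma enorm_eq0 v : enorm v = 0 -> v = 0.
Proof.
move=> v0; have : enorm v ^+ 2 = 0 by rewrite v0 expr0n.
rewrite sqr_enorm dotvE => /eqP; rewrite psumr_eq0 => [/allP h|i _]; last first.
  by rewrite -expr2 sqr_ge0.
apply/rowP => j; have := h j; rewrite mem_index_enum => /(_ isT) /=.
by rewrite mulf_eq0 orbb mxE => /eqP.
Qed.

(** Cauchy-Schwarz, from the sign of the squared norm of
    [dotv u u *: v - dotv u v *: u]. *)
Lemma sqr_dotv_le u v : dotv u v ^+ 2 <= dotv u u * dotv v v.
Proof.
have h : 0 <= dotv u u * (dotv u u * dotv v v - dotv u v ^+ 2).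
  have -> : dotv u u * (dotv u u * dotv v v - dotv u v ^+ 2) =
      dotv (dotv u u *: v - dotv u v *: u) (dotv u u *: v - dotv u v *: u).
    suff E a b : dotv (a *: v - b *: u) (a *: v - b *: u) =
        a ^+ 2 * dotv v v - 2 * a * b * dotv u v + b ^+ 2 * dotv u u.
      by rewrite E; ring.
    rewrite !dotvE !mulr_sumr -sumrB -big_split /=.
    by apply: eq_bigr => j _; rewrite !mxE; ring.
  exact: dotv_ge0.
have [u0|u0] := eqVneq (dotv u u) 0.
  have -> : u = 0 by apply: enorm_eq0; rewrite /enorm u0 sqrtr0.
  by rewrite /dotv !mul0mx !mxE mul0r expr0n.
by move: h; rewrite pmulr_rge0 ?subr_ge0 // lt_def u0 dotv_ge0.
Qed.

Lemma normr_dotv_le u v : `|dotv u v| <= enorm u * enorm v.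
Proof.
rewrite -(@ler_pXn2r _ 2) // ?nnegrE ?mulr_ge0 ?enorm_ge0 //.
by rewrite exprMn !sqr_enorm real_normK ?num_real // sqr_dotv_le.
Qed.

(** The Frobenius norm bounds the set: each coordinate of [v *m A] is the inner
    product of [v] with a column of [A].  This makes the supremum defining
    [opnorm] meaningful. *)
Lemma opnorm_has_ubound A :
  has_ubound [set enorm (v *m A) | v in [set v : 'rV[R]_n | enorm v <= 1]].
Proof.
exists (Num.sqrt (\sum_j dotv (col j A)^T (col j A)^T)) => _ [v /= v1 <-].
apply: ler_wsqrtr; rewrite dotvE; apply: ler_sum => j _.
have -> : (v *m A) 0 j = dotv v (col j A)^T.
  by rewrite mxE dotvE; apply: eq_bigr => i _; rewrite !mxE.
rewrite -expr2; apply: le_trans (sqr_dotv_le _ _) _.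
rewrite -[leRHS]mul1r ler_wpM2r ?dotv_ge0 //.
by rewrite -sqr_enorm expr_le1 ?enorm_ge0.
Qed.

Lemma opnorm_ge0 A : 0 <= opnorm A.
Proof.
apply: ub_le_sup (opnorm_has_ubound A) _ _.
by exists 0 => /=; rewrite ?mul0mx ?enorm0.
Qed.

Lemma enorm_mulmx_le v A : enorm (v *m A) <= opnorm A * enorm v.
Proof.
have [v0|v0] := eqVneq (enorm v) 0.
  by rewrite (enorm_eq0 v0) mul0mx enorm0 mulr0.
have vp : 0 < enorm v by rewrite lt_def v0 enorm_ge0.
have inv_norm : `|(enorm v)^-1| = (enorm v)^-1.
  by rewrite ger0_norm ?invr_ge0 ?enorm_ge0.
rewrite -ler_pdivrMr // mulrC -[X in X * _]inv_norm.
rewrite -enormZ scalemxAl; apply: ub_le_sup (opnorm_has_ubound A) _ _.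
by exists ((enorm v)^-1 *: v) => //=; rewrite enormZ inv_norm mulVf.
Qed.

Lemma normr_quadform_le v A : `|dotv v (v *m A)| <= opnorm A * enorm v ^+ 2.
Proof.
apply: le_trans (normr_dotv_le _ _) _.
by rewrite expr2 mulrA mulrC ler_wpM2r ?enorm_ge0 // enorm_mulmx_le.
Qed.

Lemma dotv_grad g x v : differentiable g x -> dotv (grad g x) v = 'D_v g x.
Proof.
move=> dg; rewrite deriveE // [in RHS](row_sum_delta v) linear_sum dotvE.
apply: eq_bigr => j _; rewrite !mxE deriveE // linearZ /=.
by rewrite mulrC.
Qed.

(** The form in which smoothness is used; it has no factor [1 / 2], and it can be
    averaged over the components term by term. *)
Definition quadratically_majorized g (L : R) : Prop :=
  forall x v, g (x + v) <= g x + dotv (grad g x) v + L * enorm v ^+ 2.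

(** The mean value theorem on the segment from [x] to [x + v] replaces the
    increment of [g] by a directional derivative at a point at distance at most
    [enorm v] from [x].  The constant is [`|L|] rather than the sharp [`|L| / 2],
    which would require integrating along the segment. *)
Lemma lipschitz_gradient_majorized g :
    (forall x, differentiable g x) -> lipschitz_gradient g ->
  exists L, quadratically_majorized g L.
Proof.
move=> dg [L lipL]; exists `|L| => x v.
pose line (s : R) := g (x + s *: v).
have dline (s : R) : is_derive s (1 : R) line ('D_v g (x + s *: v)).
  have E : (fun h : R => h^-1 *: ((line \o shift s) (h *: 1) - line s)) =
           (fun h : R => h^-1 *: ((g \o shift (x + s *: v)) (h *: v) - g (x + s *: v))).
    apply/funext => h; rewrite /line /= [h *: 1]mulr1.
    by congr (_ *: (g _ - _)); rewrite scalerDl addrCA.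
  by split; [rewrite /derivable E; apply: diff_derivable|rewrite /derive E].
have [s] := MVT (ltr01 : 0 < 1 :> R) (fun s _ => dline s)
  (derivable_within_continuous (fun s _ => @ex_derive _ _ _ _ _ _ _ (dline s))).
rewrite in_itv /= => /andP[s0 s1].
rewrite /line subr0 mulr1 scale1r scale0r addr0 -dotv_grad // => E.
have : dotv (grad g (x + s *: v) - grad g x) v <= `|L| * enorm v ^+ 2.
  apply: le_trans (ler_norm _) _; apply: le_trans (normr_dotv_le _ _) _.
  rewrite expr2 mulrA ler_wpM2r ?enorm_ge0 //; apply: le_trans (lipL _ _) _.
  rewrite addrAC subrr add0r enormZ (gtr0_norm s0).
  apply: le_trans (ler_wpM2r _ (ler_norm L)) _.
    by rewrite mulr_ge0 ?enorm_ge0 ?ltW.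
  by rewrite ler_wpM2l // ler_piMl ?enorm_ge0 ?ltW.
have -> : dotv (grad g (x + s *: v) - grad g x) v =
    dotv (grad g (x + s *: v)) v - dotv (grad g x) v.
  by rewrite /dotv mulmxBl !mxE.
by rewrite -E; lra.
Qed.

End Euclidean_facts.

(** * Radii and descent in a trust-region scheme *)

Lemma no_bounded_summable_descent (R : realType) (psi s : nat -> R) (c S kappa : R) :
    0 < kappa -> (forall k, c <= psi k) ->
    (forall m, \sum_(0 <= k < m) s k <= S) ->
    (forall k, psi k.+1 <= psi k + s k - kappa) -> False.
Proof.
move=> kappa0 psi_lb s_sum descent.
have psi_ub m : psi m <= psi 0%N + \sum_(0 <= k < m) s k - m%:R * kappa.
  elim: m => [|m IH]; first by rewrite big_geq //; lra.
  rewrite big_nat_recr //= -natr1; apply: le_trans (descent m) _; lra.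
pose m := Num.bound `|(psi 0%N + S - c) / kappa|.
have : (psi 0%N + S - c) / kappa < m%:R.
  by apply: le_lt_trans (ler_norm _) (archi_boundP (normr_ge0 _)).
rewrite ltr_pdivrMr // => h.
have := psi_ub m; have := psi_lb m; have := s_sum m; lra.
Qed.

(** A radius can only shrink after a failure, hence from a value above [dstar];
    after that shrinking it is still above [gamma * dstar]. *)
Lemma radius_bounded_away (R : realType) (delta : nat -> R) (succ : nat -> Prop)
    (dmax gamma dstar : R) :
    0 < gamma < 1 -> 0 < dstar ->
    (forall k, 0 < delta k <= dmax) ->
    (forall k, delta k <= dstar -> succ k) ->
    (forall k, succ k -> delta k.+1 = Num.min dmax (gamma^-1 * delta k)) ->
    (forall k, ~ succ k -> delta k.+1 = gamma * delta k) ->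
  exists2 dmin, 0 < dmin & forall k, dmin <= delta k.
Proof.
move=> /andP[g0 g1] ds0 drange small_succ dS dF.
exists (Num.min (delta 0%N) (gamma * dstar)) => [|k].
  by rewrite lt_min mulr_gt0 // andbT; case/andP: (drange 0%N).
elim: k => [|k IH]; first by rewrite ge_min lexx.
have /andP[dk0 dkm] := drange k.
have [sk|nsk] := pselect (succ k).
  rewrite dS // le_min; apply/andP; split; first exact: le_trans IH dkm.
  by apply: le_trans IH _; rewrite ler_peMl ?ltW // invf_gt1.
rewrite dF // ge_min ler_pM2l //; apply/orP; right.
by rewrite leNgt; apply/negP => /ltW /small_succ.
Qed.

(** [phi] alone does not decrease at failures, and the number of consecutive
    failures is not bounded a priori; adding a multiple of the radius to [phi]
    makes failures pay as well. *)
Lemma trust_region_contradiction (R : realType) (phi delta s : nat -> R)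
    (succ : nat -> Prop) (dmax gamma dstar c S a b : R) :
    0 < gamma < 1 -> 0 < dstar -> 0 < a -> 0 < b ->
    (forall k, 0 < delta k <= dmax) ->
    (forall k, c <= phi k) ->
    (forall k, 0 <= s k) -> (forall m, \sum_(0 <= k < m) s k <= S) ->
    (forall k, delta k <= dstar -> succ k) ->
    (forall k, succ k -> phi k.+1 <= phi k + s k - a * Num.min (delta k) b) ->
    (forall k, ~ succ k -> phi k.+1 = phi k) ->
    (forall k, succ k -> delta k.+1 = Num.min dmax (gamma^-1 * delta k)) ->
    (forall k, ~ succ k -> delta k.+1 = gamma * delta k) -> False.
Proof.
move=> grange ds0 a0 b0 drange phi_lb s0 s_sum small_succ phiS phiF dS dF.
have [dmin dmin0 dmin_le] :=
  radius_bounded_away grange ds0 drange small_succ dS dF.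
have /andP[g0 g1] := grange.
have dmax0 : 0 < dmax by have /andP[] := drange 0%N; exact: lt_le_trans.
pose drop := a * Num.min dmin b.
have drop0 : 0 < drop by rewrite mulr_gt0 // lt_min dmin0.
(* With this weight a radius increase, at most [dmax], uses up only half of the
   decrease of [phi] at a success. *)
pose w := drop / (2 * dmax).
have w0 : 0 < w by rewrite divr_gt0 // mulr_gt0.
have wdmax : w * dmax = drop / 2 by rewrite /w; field; rewrite gt_eqF.
pose kappa := Num.min (drop / 2) (w * ((1 - gamma) * dmin)).
apply: (@no_bounded_summable_descent _ (fun k => phi k + w * delta k) s c S kappa)
  => // [|k|k].
- have gp : 0 < 1 - gamma by rewrite subr_gt0.
  rewrite lt_min; apply/andP; split; [exact: divr_gt0|].
  by apply: mulr_gt0 => //; apply: mulr_gt0.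
- by have /andP[dk0 _] := drange k; rewrite ler_wpDr // mulr_ge0 // ltW.
have [sk|nsk] := pselect (succ k).
- have kd : kappa <= drop / 2 by rewrite ge_min lexx.
  have := phiS _ sk.
  have : drop <= a * Num.min (delta k) b.
    by rewrite ler_pM2l // le_min !ge_min dmin_le lexx orbT.
  have : w * delta k.+1 <= drop / 2.
    by rewrite -wdmax ler_pM2l //; have /andP[] := drange k.+1.
  have : 0 <= w * delta k by have /andP[dk0 _] := drange k; rewrite mulr_ge0 // ltW.
  by lra.
have kd : kappa <= w * ((1 - gamma) * dmin) by rewrite ge_min lexx orbT.
have : w * ((1 - gamma) * dmin) <= w * ((1 - gamma) * delta k).
  by rewrite ler_pM2l // ler_pM2l ?subr_gt0.
rewrite phiF // dF //; have := s0 k; lra.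
Qed.

(** * Maxima, the marginal function and lower limits *)

Section Maxq_facts.
Variables (R : realType) (q : nat).
Implicit Types (F G : 'I_q.+1 -> R).

Lemma le_maxq F i : F i <= maxq F.
Proof. exact: le_bigmax. Qed.

Lemma maxq_le F c : (forall i, F i <= c) -> maxq F <= c.
Proof. by move=> Fc; apply: bigmax_le. Qed.

Lemma maxq_leD F G c : (forall i, F i <= G i + c) -> maxq F <= maxq G + c.
Proof.
by move=> FG; apply: maxq_le => i; apply: le_trans (FG i) _; rewrite lerD2r le_maxq.
Qed.

End Maxq_facts.

(** The direction 0 gives the value 0.  Cauchy-Schwarz bounds the set below, so
    that its infimum is not a default value. *)
Lemma marginal_ge0 (R : realType) (n q : nat)
    (g : 'I_q.+1 -> 'rV[R]_n -> R) (x : 'rV[R]_n) : 0 <= marginal g x.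
Proof.
rewrite oppr_ge0; apply: ge_inf.
  exists (- enorm (grad (g ord0) x)) => _ [v /= v1 <-].
  apply: le_trans (le_maxq _ ord0).
  have := normr_dotv_le (grad (g ord0) x) v.
  rewrite ler_norml => /andP[+ _]; apply: le_trans.
  by rewrite lerN2 ler_piMr ?enorm_ge0.
exists 0 => /=; first by rewrite enorm0 ler01.
apply/eqP; rewrite eq_le maxq_le => [|i]; last by rewrite dotv0.
by rewrite -[leLHS](dotv0 (grad (g ord0) x)) (le_maxq (fun i => dotv (grad (g i) x) 0)).
Qed.

Lemma liminf_eq0 (R : realType) (u : nat -> R) :
    (forall k, 0 <= u k) ->
    (forall e K, 0 < e -> exists2 k, (K <= k)%N & u k < e) ->
  limn_einf (fun k => (u k)%:E) = 0%E.
Proof.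
move=> u0 usmall; rewrite limn_einf_lim.
have /cvg_lim -> // := @cvg_einfs_sup R (fun k => (u k)%:E).
apply/eqP; rewrite eq_le; apply/andP; split.
  apply: ge_ereal_sup => _ [m _ <-]; apply/lee_addgt0Pr => e e0; rewrite add0e.
  have [k mk uk] := usmall e m e0.
  apply: (@le_trans _ _ (u k)%:E); last by rewrite lee_fin ltW.
  by apply: ereal_inf_lbound; exists k.
apply: (@le_trans _ _ (einfs (fun k => (u k)%:E) 0%N)).
  by apply/ereal_infP => _ [k _ <-]; rewrite lee_fin.
by apply: ereal_sup_ubound; exists 0%N.
Qed.

(** * The full-sample objectives *)

Section Finite_sums.
Variables (R : realType) (n q N : nat) (f : 'I_q.+1 -> 'I_N -> 'rV[R]_n -> R).

Lemma set_average_full (S : 'I_q.+1 -> {set 'I_N}) :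
  (forall i, #|S i| = N) -> set_average f S = objective f.
Proof.
move=> SN; apply/funext => i; apply/funext => x; rewrite /set_average /objective.
rewrite SN; congr (_ * _); apply: eq_bigl => j.
have card_full : #|S i| = #|'I_N| by rewrite card_ord.
by rewrite (elimT (subset_cardP card_full) (subset_predT _)).
Qed.

Lemma is_derive_objective i (x v : 'rV[R]_n) :
    (forall j, differentiable (f i j) x) ->
  differentiable (objective f i) x /\
  'D_v (objective f i) x = N%:R^-1 * \sum_(j < N) 'D_v (f i j) x.
Proof.
move=> df; have -> : objective f i = N%:R^-1 *: \sum_(j < N) f i j.
  by apply/funext => y; rewrite /objective fctE fct_sumE.
split; first exact/differentiableZ/differentiable_sum.
have dv j : derivable (f i j) x v by apply: diff_derivable.
by rewrite deriveZ ?derive_sum //; apply: derivable_sum.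
Qed.

Lemma objective_majorized :
    smooth_components f ->
  exists2 L, 0 <= L & forall i, quadratically_majorized (objective f i) L.
Proof.
move=> smooth.
have /choice [L maj] : forall ij : 'I_q.+1 * 'I_N, exists L,
    quadratically_majorized (f ij.1 ij.2) L.
  by case=> i j; have [df lf] := smooth i j; apply: lipschitz_gradient_majorized.
pose Li i := N%:R^-1 * \sum_(j < N) `|L (i, j)|.
have Li0 i : 0 <= Li i by rewrite mulr_ge0 ?invr_ge0 ?ler0n ?sumr_ge0.
exists (maxq Li) => [|i x v]; first exact: le_trans (Li0 ord0) (le_maxq _ _).
have [dobj Dobj] := is_derive_objective v (fun j => (smooth i j).1 x).
apply: (@le_trans _ _ (objective f i x + dotv (grad (objective f i) x) v
                       + Li i * enorm v ^+ 2)); last first.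
  by rewrite lerD2l ler_wpM2r ?sqr_ge0 // (le_maxq Li).
rewrite dotv_grad // Dobj /objective /Li -mulrA mulr_suml -!mulrDr.
rewrite ler_wpM2l ?invr_ge0 ?ler0n // -!big_split /=; apply: ler_sum => j _.
rewrite -dotv_grad; last exact: (smooth i j).1.
apply: le_trans (maj (i, j) x v) _.
by rewrite lerD2l ler_wpM2r ?sqr_ge0 // ler_norm.
Qed.

Lemma phi_objective_bounded_below :
    (forall i j, bounded_from_below (f i j)) ->
  exists c, forall x, c <= phi (objective f) x.
Proof.
move=> lb; have /choice [c cle] := lb ord0.
exists (N%:R^-1 * \sum_j c j) => x; apply: le_trans (le_maxq _ ord0).
by rewrite ler_wpM2l ?invr_ge0 ?ler0n // ler_sum.
Qed.

End Finite_sums.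

(** * One iteration *)

Section Iteration.
Variables (R : realType) (n q N : nat) (f : 'I_q.+1 -> 'I_N -> 'rV[R]_n -> R).
Variable p : asmop_params R.
Implicit Types (s : state R n q N) (k : nat).

Lemma model0 s : model f s 0 = phi (set_average f (smp s)) (iterate s).
Proof.
rewrite /model /phi; congr maxq; apply/funext => i.
by rewrite dotv0 mul0mx dotv0 mulr0 !addr0.
Qed.

Lemma opnorm_happrox_le s cb i : beta s <= cb -> opnorm (happrox s i) <= cb.
Proof.
rewrite /beta => bcb; apply: le_trans (le_maxq (fun i => opnorm (happrox s i)) i) _.
by lra.
Qed.

Lemma beta_gt0 s : 0 < beta s.
Proof.
rewrite ltr_wpDr //; apply: le_trans (opnorm_ge0 (happrox s ord0)) _.
exact: (le_maxq (fun i => opnorm (happrox s i))).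
Qed.

Lemma model_decrease s e cb :
    adequate_step f s -> 0 < radius s -> 0 < e <= submarginal f s ->
    beta s <= cb ->
  2^-1 * e * Num.min (radius s) (e / cb) <= model f s 0 - model f s (dir s).
Proof.
move=> [_ pred] rad0 /andP[e0 eX] bcb; apply: le_trans pred.
have b0 := beta_gt0 s; have cb0 : 0 < cb by apply: lt_le_trans bcb.
apply: ler_pM; first by rewrite mulr_ge0 ?ltW.
- by rewrite ltW // lt_min rad0 divr_gt0.
- by rewrite ler_pM2l.
rewrite le_min !ge_min lexx /=; apply/orP; right.
by apply: ler_pM => //; rewrite ?invr_ge0 ?lef_pV2 ?posrE // ltW.
Qed.

(** Model and objective share their affine part, so only two quadratic errors
    remain: [L] from the objective and [cb] from the matrices [H_k^i]. *)
Lemma phi_trial_le s L cb :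
    (forall i, quadratically_majorized (set_average f (smp s) i) L) ->
    0 <= L -> 0 <= cb -> beta s <= cb -> enorm (dir s) <= radius s ->
  phi (set_average f (smp s)) (trial s)
    <= model f s (dir s) + (L + cb) * radius s ^+ 2.
Proof.
move=> maj L0 cb0 bcb drad; apply: maxq_leD => i.
apply: le_trans (maj i _ _) _; rewrite -!addrA lerD2l lerD2l.
have e2 : enorm (dir s) ^+ 2 <= radius s ^+ 2.
  by rewrite ler_pXn2r // nnegrE ?enorm_ge0 // (le_trans _ drad) ?enorm_ge0.
have := normr_quadform_le (dir s) (happrox s i).
rewrite ler_norml => /andP[quad _].
have : opnorm (happrox s i) * enorm (dir s) ^+ 2 <= cb * radius s ^+ 2.
  by rewrite ler_pM ?opnorm_ge0 ?sqr_ge0 // opnorm_happrox_le.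
have : L * enorm (dir s) ^+ 2 <= L * radius s ^+ 2 by rewrite ler_wpM2l.
have : 0 <= cb * radius s ^+ 2 by rewrite mulr_ge0 ?sqr_ge0.
by lra.
Qed.

(** The denominator of [rhoN] is negative, so clearing it reverses the
    inequality. *)
Lemma successfulE k s :
    model f s (dir s) < model f s 0 ->
  successful f p k s <->
  phi (set_average f (smp s)) (trial s)
    <= phi (set_average f (smp s)) (iterate s) + radius s * tseq p k
       - eta p * (model f s 0 - model f s (dir s)).
Proof.
move=> dec; rewrite /successful /rhoN ler_ndivlMr ?subr_lt0 //.
by split=> h; lra.
Qed.

End Iteration.

(** * Paths with full samples *)

Lemma positive_summable_partial_sums (R : realType) (u : nat -> R) :
    positive_summable u ->
  exists S, forall K m, \sum_(0 <= k < m) u (K + k)%N <= S.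
Proof.
move=> [u0 [S uS]]; exists S => K m.
have -> : \sum_(0 <= k < m) u (K + k)%N = \sum_(K <= k < K + m) u k.
  have := big_addn 0%N (K + m)%N K xpredT u; rewrite add0n addKn => ->.
  by apply: eq_bigr => k _; rewrite addnC.
rewrite -lee_fin -sumEFin; apply: le_trans _ uS.
apply: le_trans (nneseries_lim_ge (K + m)%N _) => [|k _ _]; last first.
  by rewrite lee_fin ltW.
rewrite (big_cat_nat (leq0n K) (leq_addr m K)) /= leeDr // sume_ge0 // => k _.
by rewrite lee_fin ltW.
Qed.

Section Path.
Variables (R : realType) (n q N : nat) (f : 'I_q.+1 -> 'I_N -> 'rV[R]_n -> R).
Variables (p : asmop_params R) (x0 : 'rV[R]_n) (r : nat -> state R n q N).
Hypotheses (p_valid : valid_params p) (r_path : asmop_path f p x0 r).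

Lemma radius_range k : 0 < radius (r k) <= delta_max p.
Proof.
have [/andP[d0 dm] /andP[g0 g1] _ _ _] := p_valid.
have [_ r0 _ step] := r_path.
elim: k => [|k /andP[IH0 IHm]]; first by rewrite r0 d0 ltW.
have [_ _ _ _ [radS radF]] := step k.
have [sk|nsk] := pselect (successful f p k (r k)).
  rewrite radS // lt_min ge_min lexx /= andbT (lt_trans d0 dm) /=.
  by rewrite mulr_gt0 // invr_gt0.
rewrite radF // mulr_gt0 //=; apply: le_trans IHm.
by rewrite ler_piMl // ltW.
Qed.

(** With full samples [mb_phase] is false and [move_condition] reduces to
    [successful]. *)
Lemma full_iterate_update k :
    (forall i, #|smp (r k) i| = N) ->
  (successful f p k (r k) -> iterate (r k.+1) = trial (r k)) /\
  (~ successful f p k (r k) -> iterate (r k.+1) = iterate (r k)).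
Proof.
move=> full; have [_ _ _ /(_ k) [_ _ _ [moveT moveF] _]] := r_path.
split=> [sk|nsk]; [apply: moveT | apply: moveF].
  split=> // /existsP[i]; by rewrite /nonfull full ltnn.
by case.
Qed.

(** Otherwise the iterations from [K] on would satisfy the hypotheses of
    [trust_region_contradiction]. *)
Lemma full_sample_marginal_small K (cb e : R) :
    smooth_components f -> (forall i j, bounded_from_below (f i j)) ->
    (forall k, beta (r k) <= cb) ->
    (forall k, (K <= k)%N -> forall i, #|smp (r k) i| = N) -> 0 < e ->
  exists2 k, (K <= k)%N & marginal (objective f) (iterate (r k)) < e.
Proof.
move=> smooth lb bcb full e0; apply: contrapT => none.
have omega_ge k : (K <= k)%N -> e <= marginal (objective f) (iterate (r k)).
  by move=> Kk; rewrite leNgt; apply/negP => ke; apply: none; exists k.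
have [L L0 maj] := objective_majorized smooth.
have [c phi_lb] := phi_objective_bounded_below lb.
have [_ grange _ /andP[eta0 eta_lt] [t_summable _]] := p_valid.
have [S tS] := positive_summable_partial_sums t_summable.
have t_ge0 k : 0 <= tseq p k by rewrite ltW // t_summable.1.
have dmax_ge0 : 0 <= delta_max p.
  by have /andP[rad0 radm] := radius_range 0; apply: ltW (lt_le_trans rad0 radm).
have avg k : (K <= k)%N -> set_average f (smp (r k)) = objective f.
  by move=> /full /set_average_full.
have cb0 : 0 < cb := lt_le_trans (beta_gt0 (r 0%N)) (bcb 0%N).
have dec k : (K <= k)%N ->
    2^-1 * e * Num.min (radius (r k)) (e / cb)
      <= model f (r k) 0 - model f (r k) (dir (r k)).
  move=> Kk; have [_ _ _ /(_ k) [adeq _ _ _ _]] := r_path.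
  have /andP[rad0 _] := radius_range k.
  by apply: model_decrease; rewrite // e0 /submarginal avg // omega_ge.
have ecb0 : 0 < e / cb by rewrite divr_gt0.
have succE k : (K <= k)%N -> successful f p k (r k) <->
    phi (objective f) (trial (r k))
      <= phi (objective f) (iterate (r k)) + radius (r k) * tseq p k
         - eta p * (model f (r k) 0 - model f (r k) (dir (r k))).
  move=> Kk; rewrite -(avg _ Kk); apply: successfulE.
  rewrite -subr_gt0; apply: lt_le_trans (dec _ Kk).
  have /andP[rad0 _] := radius_range k.
  by rewrite mulr_gt0 ?lt_min ?rad0 // mulr_gt0.
(* The share of the predicted decrease, per unit of radius, that may be lost to
   the quadratic error without failing the test [eta p <= rhoN]. *)
pose slope := (1 - eta p) * (2^-1 * e).
have slope0 : 0 < slope by rewrite mulr_gt0 ?mulr_gt0 //; lra.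
have Lcb0 : 0 < L + cb by lra.
apply: (@trust_region_contradiction R
  (fun k => phi (objective f) (iterate (r (K + k)%N)))
  (fun k => radius (r (K + k)%N))
  (fun k => delta_max p * tseq p (K + k)%N)
  (fun k => successful f p (K + k)%N (r (K + k)%N))
  (delta_max p) (gamma1 p) (Num.min (e / cb) (slope / (L + cb)))
  c (delta_max p * S) (eta p * (2^-1 * e)) (e / cb)) => //.
- by rewrite lt_min ecb0 divr_gt0.
- by rewrite !mulr_gt0.
- by move=> k; apply: radius_range.
- by move=> k; rewrite mulr_ge0.
- by move=> m; rewrite -mulr_sumr ler_wpM2l.
- move=> k; set j := (K + k)%N; have Kj : (K <= j)%N by apply: leq_addr.
  have /andP[rad0 _] := radius_range j.
  rewrite le_min => /andP[rad_ecb]; rewrite ler_pdivlMr // => rad_slope.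
  have [_ _ _ /(_ j) [[drad _] _ _ _ _]] := r_path.
  apply/succE => //.
  have majj i : quadratically_majorized (set_average f (smp (r j)) i) L.
    by rewrite avg.
  have := phi_trial_le majj L0 (ltW cb0) (bcb j) drad.
  have := model0 f (r j); rewrite avg //.
  have := dec j Kj; rewrite min_l // => pred.
  have : (L + cb) * radius (r j) ^+ 2 <= slope * radius (r j).
    by rewrite expr2 mulrA ler_wpM2r ?(ltW rad0) // mulrC.
  have : slope * radius (r j)
      <= (1 - eta p) * (model f (r j) 0 - model f (r j) (dir (r j))).
    rewrite /slope -mulrA ler_wpM2l //; lra.
  have : 0 <= radius (r j) * tseq p j by rewrite mulr_ge0 ?(ltW rad0).
  by lra.
- move=> k; set j := (K + k)%N => sj; have Kj : (K <= j)%N by apply: leq_addr.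
  rewrite addnS (full_iterate_update (full j Kj)).1 //.
  apply: le_trans ((succE j Kj).1 sj) _; apply: lerB.
    rewrite lerD2l ler_wpM2r //.
    by have /andP[] := radius_range j.
  by rewrite -!mulrA ler_pM2l // mulrA dec.
- move=> k nsj; rewrite addnS (full_iterate_update _).2 //.
  by move=> i; apply: full; apply: leq_addr.
- move=> k sj; have [_ _ _ /(_ (K + k)%N) [_ _ _ _ [radS _]]] := r_path.
  by rewrite addnS radS.
- move=> k nsj; have [_ _ _ /(_ (K + k)%N) [_ _ _ _ [_ radF]]] := r_path.
  by rewrite addnS radF.
Qed.

End Path.

(** * The event FS *)

(** [MB] is a finite union of countable intersections of events about the
    discrete, measurable sample sizes. *)
Lemma measurable_FS (R : realType) (n q N : nat) (d : measure_display)
    (T : measurableType d) (run : T -> nat -> state R n q N)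
    (F : nat -> set (set T)) :
  filtration F -> adapted F run -> measurable (FS run).
Proof.
move=> filt adapt; apply: measurableC.
have -> : MB run =
    \bigcup_(i in [set: 'I_q.+1]) \bigcap_k [set w | #|smp (run w k) i| < N]%N.
  apply/seteqP; split=> [w [i small]|w [i _ small]].
    by exists i => // k _; apply: small.
  by exists i => k; apply: small.
apply: fin_bigcup_measurable => // i _; apply: bigcap_measurable => // k _.
have [_ _ into] := filt k; have [_ _ _ smp_meas _] := adapt k.
exact: (into _ (smp_meas i [set S : {set 'I_N} | (#|S| < N)%N])).
Qed.

Theorem theorem2 (R : realType) (n q N : nat) (hN : (0 < N)%N)
    (f : 'I_q.+1 -> 'I_N -> 'rV[R]_n -> R) (p : asmop_params R)
    (x0 : 'rV[R]_n)
    (d : measure_display) (T : measurableType d) (P : probability T R)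
    (run : T -> nat -> state R n q N) (k0 k1 : T -> nat) :
  smooth_components f ->
  valid_params p ->
  asmop_process P f p x0 run ->
  mb_time P f p run k0 ->
  fs_time run k1 ->
  C2_bounded_below f ->
  bounded_hessians f run ->
  bounded_cond_expectations P f run k0 k1 ->
  (0 < P (FS run))%E ->
  cond_prob P
    [set w | limn_einf (fun k => (marginal (objective f) (iterate (run w k)))%:E)
             = 0%E]
    (FS run) = 1%E.
Proof.
move=> smooth valid [path [F [filt adapt _]]] _ [_ full] c2 [_ [cb [_ bcb]]] _ FS0.
have lb i j : bounded_from_below (f i j) := (c2 i j).2.
rewrite /cond_prob setIidr => [|w FSw /=].
  by rewrite divee ?gt_eqF //; apply/fin_num_measure/(measurable_FS filt adapt).
apply: liminf_eq0 => [k|e K e0]; first exact: marginal_ge0.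
have [k Kk small] := full_sample_marginal_small (K := maxn (k1 w) K) valid (path w)
  smooth lb (bcb w) (fun k kK => full w FSw k (leq_trans (leq_maxl _ _) kK)) e0.
by exists k => //; apply: leq_trans Kk; apply: leq_maxr.
Qed.
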